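(* Let $(X_n)_{n\in\mathbb{N}}$ be a Markov chain with transition matrix $P$ and initial distribution $\nu$, let $P$ be reversible with respect to $\pi$, and let $0<\beta<1$. Suppose that $$n_0= \max\left\{\left\lceil \frac{\log\left(\sqrt{\|\frac{1}{\pi}\|_{\infty}}\, \|\frac{\nu}{\pi}-1\|_{2}\right)}{\log(\beta^{-1})}\right\rceil,\,0\right\}.$$ Then for all $n\in\mathbb{N}$ $$\frac{1+\beta_1}{n(1-\beta_1)}- \frac{4}{n^2(1-\beta)^2} \;\leq\; \sup_{\|f\|_{2}\leq1}e_\nu(S_{n,n_0},f)^2 \;\leq\; \frac{2}{n(1-\beta_1)} + \frac{2}{n^2(1-\beta)^2}.$$
   Context: $\mathbb{N}=\{1,2,\dots\}$. $D$ is a finite set (with $|D|\ge 2$). A Markov chain $(X_n)_{n\in\mathbb{N}}$ on $D$ with transition matrix $P=(p(x,y))_{x,y\in D}$ and initial distribution $\nu$ satisfies $\Pr(X_1=x)=\nu(x)$ and $\Pr(X_{n+1}=y\mid X_1,\dots,X_n)=p(X_n,y)$. Throughout, $P$ is irreducible, aperiodic and reversible with respect to a probability measure $\pi$ on $D$, i.e. $\pi(x)p(x,y)=\pi(y)p(y,x)$ for all $x,y\in D$; then $\pi$ is the unique stationary distribution and $\pi(x)>0$ for all $x$. On $\mathbb{R}^D$ let $\langle f,g\rangle=\sum_{x\in D} f(x)g(x)\pi(x)$, $\|f\|_2=\langle f,f\rangle^{1/2}$ and $\|f\|_\infty=\max_{x\in D}|f(x)|$; $\frac1\pi$ and $\frac{\nu}{\pi}$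 denote the functions $x\mapsto 1/\pi(x)$ and $x\mapsto \nu(x)/\pi(x)$. $P$ acts by $Pf(x)=\sum_y f(y)p(x,y)$ and is self-adjoint for $\langle\cdot,\cdot\rangle$. Its eigenvalues (with multiplicity) are $1=\beta_0>\beta_1\ge\dots\ge\beta_{|D|-1}$. Put $\beta=\max\{\beta_1,|\beta_{|D|-1}|\}$. $S(f)=\sum_{x\in D}f(x)\pi(x)$, $S_{n,n_0}(f)=\frac1n\sum_{j=1}^n f(X_{j+n_0})$, and $e_\nu(S_{n,n_0},f)=\big(\mathbf{E}_{\nu,P}|S_{n,n_0}(f)-S(f)|^2\big)^{1/2}$, the expectation being taken for the Markov chain with transition matrix $P$ and initial distribution $\nu$. Supremum is over $f\in\mathbb{R}^D$. Convention: $\log 0=-\infty$, so $n_0=0$ if $\nu=\pi$. *)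

(* Defs.v *)
From HB Require Import structures.
From mathcomp Require Import all_boot all_order all_algebra.
From mathcomp Require Import polyrcf.
From mathcomp Require Import all_classical all_reals all_analysis.

Set Implicit Arguments.
Unset Strict Implicit.
Unset Printing Implicit Defensive.

Import Order.TTheory GRing.Theory Num.Theory.
Import numFieldNormedType.Exports.

Local Open Scope classical_set_scope.
Local Open Scope ring_scope.

Section FiniteStateSpace.
Context {R : realType} {D : finType}.
Implicit Types (p : D -> D -> R) (pi nu f g : D -> R).

Definition is_distr nu := (forall x, 0 <= nu x) /\ \sum_x nu x = 1.

Definition stochastic p := forall x, is_distr (p x).

Definition transition_op p f : D -> R := fun x => \sum_y f y * p x y.

(* The (x, y) entry of P^n, as the value at x of P^n applied to the indicator
   function of {y}. *)
Definition step_prob p (n : nat) (x y : D) : R :=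
  iter n (transition_op p) (fun z => (z == y)%:R) x.

Definition irreducible p :=
  forall x y, exists n : nat, (0 < n)%N /\ 0 < step_prob p n x y.

(* gcd {n >= 1 | P^n(x, x) > 0} = 1 for every x *)
Definition aperiodic p :=
  forall (x : D) (d : nat),
    (forall n : nat, (0 < n)%N -> 0 < step_prob p n x x -> (d %| n)%N) ->
    d = 1%N.

Definition reversible p pi := forall x y, pi x * p x y = pi y * p y x.

Definition mean pi f : R := \sum_x f x * pi x.

Definition inner pi f g : R := \sum_x f x * g x * pi x.

Definition l2norm pi f : R := Num.sqrt (inner pi f f).

Definition linfnorm f : R := \big[Num.max/0]_(x : D) `|f x|.

Definition transition_mx p : 'M[R]_#|D| :=
  \matrix_(i, j) p (enum_val i) (enum_val j).

(* The real eigenvalues of P, in decreasing order, each repeated according to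
   its multiplicity as a root of the characteristic polynomial.  When P is
   reversible with respect to a positive measure, all eigenvalues are real and
   semisimple, so this is the full spectrum, of length #|D|. *)
Definition eigenvalues p : seq R :=
  let chi := char_poly (transition_mx p) in
  sort >=%R (flatten [seq nseq (mup a chi) a | a <- rootsR chi]).

Definition beta_ p (i : nat) : R := (eigenvalues p)`_i.

Definition beta_star p : R := Num.max (beta_ p 1) `|beta_ p #|D|.-1|.

(* The case distinction is the convention log 0 = -oo. *)
Definition burn_in p pi nu : int :=
  let a := Num.sqrt (linfnorm (fun x => (pi x)^-1)) *
           l2norm pi (fun x => nu x / pi x - 1) in
  if a == 0 then 0
  else Num.max (Num.ceil (ln a / ln (beta_star p)^-1)) 0.

End FiniteStateSpace.

Section Process.
Context {d : measure_display} {T : measurableType d} {R : realType}.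
Context {D : finType}.
Variable Pr : probability T R.
Implicit Types (p : D -> D -> R) (pi nu f : D -> R) (X : nat -> T -> D).

Definition cond_prob (A B : set T) : R := fine (Pr (A `&` B)) / fine (Pr B).

(* Time runs over n >= 1; X 0 is never used.  The state space D carries the
   discrete sigma-algebra, and conditioning on X_1, ..., X_n is conditioning on
   each of the events {X_1 = x_1, ..., X_n = x_n} of positive probability. *)
Definition markov_chain p nu X :=
  [/\ forall (n : nat) (x : D), (0 < n)%N -> measurable [set w | X n w = x],
      forall x : D, Pr [set w | X 1%N w = x] = (nu x)%:E &
      forall (n : nat) (x : nat -> D) (y : D), (0 < n)%N ->
        let past := [set w | forall k, (1 <= k <= n)%N -> X k w = x k] in
        (0 < Pr past)%E ->
        cond_prob [set w | X n.+1 w = y] past = p (x n) y].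

Definition mcmc_avg X (n n0 : nat) f (w : T) : R :=
  n%:R^-1 * \sum_(1 <= j < n.+1) f (X (j + n0)%N w).

Definition mcmc_error X pi (n n0 : nat) f : \bar R :=
  sqrte ('E_Pr[fun w => (`|mcmc_avg X n n0 f w - mean pi f| ^+ 2)%R])%E.

End Process.

(* Main.v *)
(**
Since [P] is self-adjoint for [<.,.>] and [1] is a simple eigenvalue, every
mean-zero [g] carries nonnegative weights [w_i] on the eigenvalues
[e_i <= beta_1], [|e_i| <= beta], such that [<g, P^k g> = sum_i w_i e_i^k].
Hence the stationary second moment of [g(X_1) + ... + g(X_n)] is a mixture of
the numbers [sum_{i,j} e^|i-j|], which a geometric sum controls, and it is
explicit when [g] is an eigenfunction for [beta_1].  Starting from [nu] instead
of [pi] changes [E (g P^k g)(X_{n0+j+1})] by at most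
[beta^(n0+j+k) ||1/pi||_oo^(1/2) ||nu/pi - 1||_2 <= beta^(j+k)], by the choice
of [n0]; these errors add up to at most
[sum_{m<n} (1 + 2m) beta^m <= 2 / (1 - beta)^2].
*)
Require Import Defs.
From HB Require Import structures.
From mathcomp Require Import all_boot all_order all_algebra.
From mathcomp Require Import polyrcf.
From mathcomp Require Import complex zify ring lra.
From mathcomp Require Import all_classical all_reals all_analysis.

Set Implicit Arguments.
Unset Strict Implicit.
Unset Printing Implicit Defensive.

Import Order.TTheory GRing.Theory Num.Theory.
Import numFieldNormedType.Exports.

Local Open Scope classical_set_scope.
Local Open Scope ring_scope.

(** * The spectrum of a reversible chain *)

(** The intertwining by [S] extends to the characteristic matrices, and the nonzero determinant of
    [S] cancels from both sides. *)
Lemma char_poly_similar (F : fieldType) n (S A B : 'M[F]_n) :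
  S \in unitmx -> A *m S = S *m B -> char_poly A = char_poly B.
Proof.
move=> uS AS.
have dS : \det (map_mx polyC S) != 0.
  by rewrite det_map_mx polyC_eq0 -unitfE -unitmxE.
apply: (mulIf dS); rewrite -det_mulmx mulrC -det_mulmx; congr (\det _).
rewrite /char_poly_mx mulmxBl mulmxBr -!map_mxM AS.
by rewrite mul_scalar_mx mul_mx_scalar.
Qed.

(* [c v] lists the coordinates of [v] in a complex orthonormal eigenbasis; the
   diagonalization theorem is available over [R[i]] only. *)
Lemma symmetric_spectral (R : rcfType) n (A : 'M[R]_n) : A^T = A ->
  exists (e : 'I_n -> R) (c : 'rV[R]_n -> 'I_n -> R[i]),
  [/\ char_poly A = \prod_i ('X - (e i)%:P),
      forall v w : 'rV[R]_n,
        (((v *m w^T) 0 0)%:C)%C = \sum_i c v i * (c w i)^*%C &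
      forall v i, c (v *m A) i = c v i * ((e i)%:C)%C].
Proof.
move=> sA.
pose AC : 'M[R[i]]_n := map_mx (real_complex R) A.
have realAC : AC \is a realmx.
  by apply/mxOverP => i j; rewrite mxE complex_real.
have symAC : AC \is symmetricmx.
  apply/is_hermitianmxP; rewrite expr0 scale1r map_mx_id //.
  by rewrite /AC map_trmx sA.
have hermAC := realsym_hermsym symAC realAC.
have AE := orthomx_spectralP (hermitian_normalmx hermAC).
have realD := hermitian_spectral_diag_real hermAC.
set U := spectralmx AC in AE; set D := spectral_diag AC in AE realD.
have uU : U \is unitarymx := spectral_unitarymx AC.
pose e i := complex.Re (D 0 i).
have DE i : D 0 i = ((e i)%:C)%C by rewrite /e RRe_real // (mxOverP realD).
pose c (v : 'rV[R]_n) i := (map_mx (real_complex R) v *m U^t* )%sesqui 0 i.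
exists e, c; split.
(* The embedding into [R[i]] is injective on polynomials, so it suffices to compare there, where the
   unitary [U] conjugates [AC] to [diag_mx D]. *)
- apply: (@map_poly_inj _ _ (real_complex R)).
  rewrite map_char_poly -/AC.
  have -> : char_poly AC = char_poly (diag_mx D).
    apply/esym/(@char_poly_similar _ _ U); first exact: unitarymx_unit.
    rewrite AE !mulmxA mulmxV ?mul1mx //; exact: unitarymx_unit.
  rewrite char_poly_trig ?diag_mx_is_trig // rmorph_prod /=.
  apply: eq_bigr => i _; rewrite rmorphB /= map_polyX map_polyC /=.
  by rewrite mxE eqxx mulr1n DE.
- move=> v w.
  have realT :
      ((map_mx (real_complex R) w)^t*)%sesqui = map_mx (real_complex R) w^T.
    by apply/matrixP => i j; rewrite !mxE; apply: conjc_real.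
  have -> : (((v *m w^T) 0 0)%:C)%C =
    (map_mx (real_complex R) v *m U^t* *m
      (map_mx (real_complex R) w *m U^t*)^t*)%sesqui 0 0.
    rewrite trmx_mul map_mxM trmxCK mulmxA mulmxKtV //.
    by rewrite realT -map_mxM [RHS]mxE.
  rewrite mxE; apply: eq_bigr => i _.
  by rewrite [in X in _ * X]mxE [in X in _ * X]mxE.
- move=> v i; rewrite /c map_mxM -/AC {1}AE invmx_unitary //.
  rewrite !mulmxA mulmxtVK // mul_mx_diag mxE.
  by rewrite -DE.
Qed.

(** * The averaging operator and the inner product weighted by [pi] *)

Section Op.
Variables (R : realType) (D : finType).
Implicit Types (p : D -> D -> R) (pi mu f g h : D -> R).

(** The shape [f + a g], kept in the companion lemmas below, covers centering ([a = -1]) and scaling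
    ([f = 0]) at once. *)
Lemma transition_opD p a f g :
  transition_op p (fun x => f x + a * g x) =1
  fun x => transition_op p f x + a * transition_op p g x.
Proof.
move=> x; rewrite /transition_op mulr_sumr -big_split /=.
by apply: eq_bigr => y _; rewrite mulrDl mulrA.
Qed.

Lemma transition_op_ext p f g : f =1 g ->
  transition_op p f =1 transition_op p g.
Proof. by move=> fg x; apply: eq_bigr => y _; rewrite fg. Qed.

Lemma iter_transition_ext p n f g : f =1 g ->
  iter n (transition_op p) f =1 iter n (transition_op p) g.
Proof. by move=> fg; elim: n => //= n IH; apply: transition_op_ext. Qed.

Lemma iter_transition_opD p a f g n :
  iter n (transition_op p) (fun x => f x + a * g x) =1
  fun x => iter n (transition_op p) f x + a * iter n (transition_op p) g x.
Proof.
elim: n => //= n IH x; rewrite -transition_opD; exact: transition_op_ext.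
Qed.

Lemma transition_op_cst p a : stochastic p ->
  transition_op p (fun=> a) =1 fun=> a.
Proof.
by move=> sp x; rewrite /transition_op -mulr_sumr (sp x).2 mulr1.
Qed.

Lemma iter_transition_cst p a n : stochastic p ->
  iter n (transition_op p) (fun=> a) =1 fun=> a.
Proof.
move=> sp; elim: n => //= n IH x.
by rewrite (transition_op_ext _ IH) transition_op_cst.
Qed.

Lemma inner_ext pi f f' g g' : f =1 f' -> g =1 g' ->
  inner pi f g = inner pi f' g'.
Proof. by move=> ff gg; apply: eq_bigr => x _; rewrite ff gg. Qed.

Lemma mean_ext pi f f' : f =1 f' -> mean pi f = mean pi f'.
Proof. by move=> ff; apply: eq_bigr => x _; rewrite ff. Qed.

Lemma meanD pi a f g :
  mean pi (fun x => f x + a * g x) = mean pi f + a * mean pi g.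
Proof.
by rewrite /mean mulr_sumr -big_split /=; apply: eq_bigr => x _; ring.
Qed.

Lemma mean_cst pi a : is_distr pi -> mean pi (fun=> a) = a.
Proof. by case=> _ s1; rewrite /mean -mulr_sumr s1 mulr1. Qed.

Lemma mean_inner1 pi f : mean pi f = inner pi (fun=> 1) f.
Proof. by apply: eq_bigr => x _; rewrite mul1r. Qed.

Lemma innerC pi f g : inner pi f g = inner pi g f.
Proof. by apply: eq_bigr => x _; ring. Qed.

Lemma inner_ge0 pi f : (forall x, 0 <= pi x) -> 0 <= inner pi f f.
Proof.
by move=> pi0; apply: sumr_ge0 => x _; rewrite mulr_ge0 // -expr2 sqr_ge0.
Qed.

Lemma sqr_l2norm pi f : (forall x, 0 <= pi x) ->
  l2norm pi f ^+ 2 = inner pi f f.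
Proof. by move=> pi0; rewrite sqr_sqrtr ?inner_ge0. Qed.

Lemma l2norm_ge0 pi f : 0 <= l2norm pi f.
Proof. exact: sqrtr_ge0. Qed.

(* Lagrange's identity *)
Lemma inner_cauchy_schwarz pi f g : (forall x, 0 <= pi x) ->
  inner pi f g ^+ 2 <= inner pi f f * inner pi g g.
Proof.
move=> pi0.
pose q x y := pi x * pi y * (f x * g y - f y * g x) ^+ 2.
have q0 : 0 <= \sum_x \sum_y q x y.
  do 2![apply: sumr_ge0 => ? _]; apply: mulr_ge0; last exact: sqr_ge0.
  exact: mulr_ge0.
suff E : \sum_x \sum_y q x y =
    2 * (inner pi f f * inner pi g g - inner pi f g ^+ 2) by lra.
have E1 : inner pi f f * inner pi g g =
    \sum_x \sum_y (f x * f x * pi x) * (g y * g y * pi y).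
  by rewrite /inner big_distrlr.
have E2 : inner pi g g * inner pi f f =
    \sum_x \sum_y (g x * g x * pi x) * (f y * f y * pi y).
  by rewrite /inner big_distrlr.
have E3 : inner pi f g ^+ 2 =
    \sum_x \sum_y (f x * g x * pi x) * (f y * g y * pi y).
  by rewrite expr2 /inner big_distrlr.
rewrite mulrBr mulr_natl mulr2n {2}mulrC E1 E2 E3.
rewrite -big_split mulr_sumr -sumrB /=.
apply: eq_bigr => x _; rewrite -big_split mulr_sumr -sumrB /=.
by apply: eq_bigr => y _; rewrite /q; ring.
Qed.

End Op.

(** * Self-adjointness and diagonalization *)

Section Reversible.
Variables (R : realType) (D : finType) (p : D -> D -> R) (pi : D -> R).
Hypotheses (sp : stochastic p) (dpi : is_distr pi) (rev : reversible p pi).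
Implicit Types (f g h : D -> R).
Local Notation P := (transition_op p).

Lemma inner_transition f g : inner pi (P f) g = inner pi f (P g).
Proof.
rewrite /inner /transition_op.
under eq_bigr => x _ do rewrite -mulrA mulr_suml.
rewrite exchange_big /=; apply: eq_bigr => x _.
rewrite mulr_sumr mulr_suml; apply: eq_bigr => y _.
by rewrite -!mulrA; congr (_ * _); rewrite mulrCA [p y x * _]mulrC -rev; ring.
Qed.

Lemma inner_iter f g n : inner pi (iter n P f) g = inner pi f (iter n P g).
Proof.
by elim: n g => //= n IH g; rewrite inner_transition IH -iterSr.
Qed.

(** Self-adjointness moves [P^n] onto the constant 1, which it fixes: reversibility implies
    stationarity. *)
Lemma mean_iter f n : mean pi (iter n P f) = mean pi f.
Proof.
rewrite !mean_inner1 -inner_iter; apply: inner_ext => //.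
exact: iter_transition_cst.
Qed.

(** Each side is the matrix coefficient of the self-adjoint [P^n] between the indicators of [x] and
    [y]. *)
Lemma step_prob_rev n x y : pi x * step_prob p n x y = pi y * step_prob p n y x.
Proof.
have E z t : pi z * step_prob p n z t =
  inner pi (fun u => (u == z)%:R) (iter n P (fun u => (u == t)%:R)).
  rewrite /inner (bigD1 z) //= eqxx mul1r big1 ?addr0 1?mulrC //.
  by move=> u /negPf->; rewrite !mul0r.
by rewrite !E -inner_iter innerC.
Qed.

(** Some [y] carries mass and reaches [x] with positive probability in [n] steps; detailed balance
    for [n] steps then excludes [pi x = 0]. *)
Lemma reversible_distr_gt0 x : irreducible p -> 0 < pi x.
Proof.
move=> irr; case: dpi => pi0 s1.
have [y py] : exists y, 0 < pi y.
  apply/existsP; apply: contraTT (ltr01 : (0 : R) < 1) => /existsPn H.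
  rewrite -s1 big1 ?ltxx // => z _; apply/eqP.
  by rewrite eq_le pi0 andbT leNgt H.
have [n [_ pn]] := irr y x.
rewrite lt_neqAle pi0 andbT eq_sym; apply/eqP => px0.
have := step_prob_rev n y x; rewrite px0 mul0r => /eqP.
by rewrite mulf_eq0 !gt_eqF.
Qed.

Hypothesis pi_gt0 : forall x, 0 < pi x.

Let sqpi_neq0 x : Num.sqrt (pi x) != 0.
Proof. by rewrite gt_eqF // sqrtr_gt0. Qed.

(** The factor [sqrt pi] makes this an isometry from functions with [inner pi] to Euclidean row
    vectors. *)
Definition fun_row f : 'rV[R]_#|D| :=
  \row_i (f (enum_val i) * Num.sqrt (pi (enum_val i))).

(* By reversibility, conjugating by diag(sqrt pi) makes P symmetric. *)
Definition symmetrized_mx : 'M[R]_#|D| :=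
  \matrix_(i, j) (Num.sqrt (pi (enum_val i)) * p (enum_val i) (enum_val j)
                  / Num.sqrt (pi (enum_val j))).

Lemma sum_enum_val (F : D -> R) : \sum_x F x = \sum_(i < #|D|) F (enum_val i).
Proof. by rewrite (reindex _ (onW_bij _ (@enum_val_bij D))). Qed.

Lemma symmetrized_mx_sym : symmetrized_mx^T = symmetrized_mx.
Proof.
apply/matrixP => i j; rewrite !mxE.
set x := enum_val i; set y := enum_val j.
apply/eqP; rewrite eqr_div //; apply/eqP.
rewrite mulrAC -expr2 sqr_sqrtr ?ltW // [RHS]mulrAC -expr2 sqr_sqrtr ?ltW //.
Qed.

Lemma fun_row_inner f g : (fun_row f *m (fun_row g)^T) 0 0 = inner pi f g.
Proof.
rewrite mxE /inner sum_enum_val; apply: eq_bigr => i _; rewrite !mxE.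
by rewrite mulrACA -expr2 sqr_sqrtr // ltW.
Qed.

Lemma fun_row_transition f : fun_row (P f) = fun_row f *m symmetrized_mx.
Proof.
rewrite -symmetrized_mx_sym; apply/rowP => i; rewrite !mxE.
rewrite /transition_op sum_enum_val mulr_suml; apply: eq_bigr => j _.
by rewrite !mxE; field; exact: sqpi_neq0.
Qed.

Lemma char_poly_symmetrized :
  char_poly symmetrized_mx = char_poly (transition_mx p).
Proof.
apply: (@char_poly_similar _ _ (diag_mx (\row_i Num.sqrt (pi (enum_val i))))).
  rewrite unitmxE det_diag unitfE; apply/prodf_neq0 => i _.
  by rewrite mxE.
rewrite mul_mx_diag mul_diag_mx; apply/matrixP => i j; rewrite !mxE.
by rewrite divfK.
Qed.

Lemma reversible_spectral :
  exists (e : 'I_#|D| -> R) (c : (D -> R) -> 'I_#|D| -> R[i]),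
  [/\ char_poly (transition_mx p) = \prod_i ('X - (e i)%:P),
      forall f g, ((inner pi f g)%:C)%C = \sum_i c f i * (c g i)^*%C &
      forall n f i, c (iter n P f) i = c f i * ((e i ^+ n)%:C)%C].
Proof.
have [e [c [chi Pars equiv]]] := symmetric_spectral symmetrized_mx_sym.
exists e, (fun f => c (fun_row f)); split.
- by rewrite -char_poly_symmetrized.
- by move=> f g; rewrite -fun_row_inner Pars.
- move=> n f i; elim: n => [|n IH] /=; first by rewrite expr0 mulr1.
  by rewrite fun_row_transition equiv IH exprSr rmorphM mulrA.
Qed.

(** A real row eigenvector of the symmetric matrix, divided by [sqrt pi], is an eigenfunction of
    [P]. This yields a real function, whereas the coordinates of [reversible_spectral] are
    complex. *)
Lemma eigenfunction b : root (char_poly (transition_mx p)) b ->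
  exists2 f, inner pi f f = 1 & P f =1 fun x => b * f x.
Proof.
rewrite -char_poly_symmetrized -eigenvalue_root_char => /eigenvalueP[v vA v0].
pose f x := v 0 (enum_rank x) / Num.sqrt (pi x).
have fv : fun_row f = v.
  by apply/rowP => i; rewrite mxE /f enum_valK divfK.
have nf : 0 < inner pi f f.
  rewrite lt_neqAle inner_ge0 ?andbT; last by move=> x; exact/ltW.
  apply: contra_neq v0; rewrite -fun_row_inner fv => /esym/eqP.
  rewrite mxE psumr_eq0 => [|i _]; last by rewrite mxE -expr2 sqr_ge0.
  move=> /allP v0; apply/rowP => i; apply/eqP.
  by have := v0 i (mem_index_enum _); rewrite !mxE mulf_eq0 orbb.
have Pf x : P f x = b * f x.
  have := fun_row_transition f; rewrite fv vA => /rowP/(_ (enum_rank x)).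
  rewrite !mxE enum_rankK => Pfx.
  by rewrite -[LHS](mulfK (sqpi_neq0 x)) Pfx /f mulrA.
pose s := Num.sqrt (inner pi f f).
have s0 : s != 0 by rewrite gt_eqF // sqrtr_gt0.
(* Normalization; the summand 0 gives the shape that [transition_opD] rewrites. *)
exists (fun x => 0 + s^-1 * f x).
  have -> : inner pi (fun x => 0 + s^-1 * f x) (fun x => 0 + s^-1 * f x) =
    s ^- 2 * inner pi f f.
    by rewrite /inner mulr_sumr; apply: eq_bigr => x _; field.
  by rewrite sqr_sqrtr ?(ltW nf) // mulVf // gt_eqF.
move=> x; rewrite transition_opD Pf.
by rewrite -[fun=> 0]/(fun=> 0) transition_op_cst //; ring.
Qed.

End Reversible.

(** * The ordered list of eigenvalues *)

Lemma count_mem_flatten_nseq (T : eqType) (m : T -> nat) (s : seq T) a :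
  uniq s ->
  count_mem a (flatten [seq nseq (m b) b | b <- s]) = ((a \in s) * m a)%N.
Proof.
elim: s => [|b s IH] //= /andP[bs us].
rewrite count_cat IH // count_nseq /= in_cons eq_sym.
by have [->|] := eqVneq a b; rewrite ?(negPf bs) ?addn0 ?mul0n ?add0n ?mul1n.
Qed.

(** Every value occurs in both lists as often as its multiplicity as a root of [q]. *)
Lemma perm_roots_split (R : rcfType) (q : {poly R}) (s : seq R) :
  q = \prod_(a <- s) ('X - a%:P) ->
  perm_eq (flatten [seq nseq (mup a q) a | a <- rootsR q]) s.
Proof.
move=> qE; have q0 : q != 0 by rewrite qE monic_neq0 // monic_prod_XsubC.
have onq := roots_on_rootsR q0.
apply/allP => a _ /=; apply/eqP.
rewrite count_mem_flatten_nseq ?uniq_roots //.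
rewrite -onq in_itv /=.
by have [|/mupNroot] := boolP (root q a);
  rewrite ?mul1n ?mul0n qE mu_prod_XsubC.
Qed.

Section Spectrum.
Variables (R : realType) (D : finType) (p : D -> D -> R).
Local Notation chi := (char_poly (transition_mx p)).

Lemma perm_eigenvalues (e : 'I_#|D| -> R) :
  chi = \prod_i ('X - (e i)%:P) ->
  perm_eq (eigenvalues p) [seq e i | i : 'I_#|D|].
Proof.
move=> chiE; rewrite /eigenvalues /= perm_sort; apply: perm_roots_split.
by rewrite chiE big_map big_enum.
Qed.

(** The bound on [j] matters: past the end of the list [beta_] takes the default value 0. *)
Lemma beta_le i j : (i <= j < size (eigenvalues p))%N -> beta_ p j <= beta_ p i.
Proof.
move=> /andP[ij js].
have := @sorted_leq_nth _ (>=%R : rel R) _ _ 0 (eigenvalues p).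
apply; rewrite ?inE //; last exact: leq_ltn_trans js.
- by move=> ? ? ?; apply/ge_trans.
- by move=> ?; apply: lexx.
- by apply: sort_sorted => x y; rewrite /= orbC; apply: le_total.
Qed.

(** Since [beta_ p 1 <= beta_star p < 1], the value 1 can only stand at position 0, and only once.
    So for [i != i0] the value [e i] first occurs at a position between 1 and [#|D|.-1]. *)
Lemma one_eigenvalue_bounds (e : 'I_#|D| -> R) i0 :
  (1 < #|D|)%N -> chi = \prod_i ('X - (e i)%:P) ->
  e i0 = 1 -> beta_star p < 1 ->
  forall i, i != i0 -> beta_ p #|D|.-1 <= e i <= beta_ p 1.
Proof.
move=> D1 chiE e1 b1 i ii0.
have pe := perm_eigenvalues chiE.
have ss : size (eigenvalues p) = #|D|.
  by rewrite (perm_size pe) size_map size_enum_ord.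
have beta_lt1 k : (0 < k < #|D|)%N -> beta_ p k < 1.
  move=> kD.
  apply: le_lt_trans (beta_le (_ : (1 <= k < _)%N)) _; rewrite ?ss //.
  by apply: le_lt_trans b1; rewrite le_max lexx.
pose s := eigenvalues p.
have mem_s j : e j \in s by rewrite (perm_mem pe) map_f // mem_enum.
have index_gt0 j : (0 < index (e j) s)%N ->
    beta_ p #|D|.-1 <= e j <= beta_ p 1.
  have js : (index (e j) s < #|D|)%N by rewrite -ss index_mem mem_s.
  move=> j0.
  have -> : e j = beta_ p (index (e j) s) by rewrite /beta_ nth_index.
  move: (index _ _) j0 js => k k0 kD.
  by apply/andP; split; apply: beta_le; rewrite ss; lia.
have [i_eq0|] := posnP (index (e i) s); last exact: index_gt0.
have i0_eq0 : index (e i0) s = 0%N.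
  apply/eqP; rewrite -leqn0 leqNgt; apply/negP => /index_gt0 /andP[_].
  by rewrite e1 leNgt beta_lt1.
have ei1 : e i = 1.
  by rewrite -(nth_index 0 (mem_s i)) i_eq0 -i0_eq0 nth_index // e1.
have c1 : (count_mem 1%R s <= 1)%N.
  move: ss beta_lt1; rewrite /beta_ -/s; case: (s) => //= x t ss s1.
  rewrite (_ : count_mem 1%R t = 0%N) ?addn0 ?leq_b1 //.
  apply/count_memPn; apply/negP => /(nthP 0)[k ks sk].
  by have := s1 k.+1; rewrite /= sk ltxx -ss ltnS ks => /(_ isT).
(* The count of 1 in the list is the number of indices [j] with [e j = 1], and both [i] and [i0]
   would be among them. *)
move: c1; rewrite (permP pe) count_map.
rewrite -[count _ _](_ : #|[pred j | e j == 1]| = _).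
  move=> /card_le1_eqP/(_ i i0); rewrite !inE ei1 e1 eqxx => /(_ isT isT) ii.
  by rewrite ii eqxx in ii0.
by rewrite cardE enumT [in LHS]/enum_mem size_filter; apply: eq_count.
Qed.

End Spectrum.

(** * Spectral weights of mean-zero functions *)

Section Weights.
Variables (R : realType) (D : finType) (p : D -> D -> R) (pi : D -> R).
Hypotheses (sp : stochastic p) (dpi : is_distr pi) (rev : reversible p pi).
Local Notation chi := (char_poly (transition_mx p)).
Hypotheses (pi_gt0 : forall x, 0 < pi x) (D_gt1 : (1 < #|D|)%N).
Hypothesis beta_lt1 : beta_star p < 1.
Implicit Types (f g h : D -> R).
Local Notation P := (transition_op p).

(** The weights are the squared moduli of the coordinates of [g]. The constant 1 has its only
    nonzero coordinate at an index [i0] with [e i0 = 1], so orthogonality to constants kills the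
    weight of [g] there. The family [e] is the same for all [g]. *)
Lemma spectral_weights : exists e : 'I_#|D| -> R,
  (chi = \prod_i ('X - (e i)%:P)) /\
  forall g, mean pi g = 0 -> exists w : 'I_#|D| -> R,
  [/\ forall i, 0 <= w i,
      forall i, w i != 0 -> beta_ p #|D|.-1 <= e i <= beta_ p 1 &
      forall n, inner pi g (iter n P g) = \sum_i w i * e i ^+ n].
Proof.
have [e [c [chiE Pars equiv]]] := reversible_spectral rev pi_gt0.
exists e; split => // g g0.

have P1 : P (fun=> 1) = fun=> 1 by apply/funext => x; rewrite transition_op_cst.
have c1 i : c (fun=> 1) i != 0 -> e i = 1.
  move=> ci; have := equiv 1%N (fun=> 1) i; rewrite /= P1 expr1 => E.
  apply: complexI; apply: (mulfI ci); by rewrite -E mulr1.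
(* Otherwise Parseval would give [<1, 1> = 0], whereas it is the total mass 1. *)
have [i0 ci0] : exists i0, c (fun=> 1) i0 != 0.
  apply/existsP; apply: contraTT (ltr01 : (0 : R) < 1) => /existsPn H.
  rewrite -(mean_cst 1 dpi) mean_inner1 -(ltcR 0) Pars big1 ?ltxx // => i _.
  by have /negPn/eqP -> := H i; rewrite mul0r.
have bounds := one_eigenvalue_bounds D_gt1 chiE (c1 _ ci0) beta_lt1.
have c1_eq0 i : i != i0 -> c (fun=> 1) i = 0.
  move=> ii0; apply/eqP; apply: contraT => /c1 ei1.
  have /andP[_] := bounds i ii0; rewrite ei1 leNgt.
  by rewrite (le_lt_trans _ beta_lt1) // le_max lexx.
have cg0 : c g i0 = 0.
  have := Pars (fun=> 1) g; rewrite -mean_inner1 g0 (bigD1 i0) //= big1 ?addr0.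
    by move=> /esym/eqP; rewrite mulf_eq0 (negPf ci0) conjc_eq0 => /eqP.
  by move=> i /c1_eq0->; rewrite mul0r.
exists (fun i => complex.Re (c g i * (c g i)^*%C)).
have wE i : ((complex.Re (c g i * (c g i)^*%C))%:C)%C = c g i * (c g i)^*%C.
  by rewrite RRe_real // ger0_real // mulcJ_ge0.
split.
- by move=> i; rewrite -(lecR 0) wE mulcJ_ge0.
- move=> i wi; apply: bounds; apply: contraNneq wi => ->.
  by rewrite cg0 mul0r.
- move=> n; apply: complexI; rewrite Pars rmorph_sum; apply: eq_bigr => i _ /=.
  by rewrite rmorphM /= wE equiv rmorphM [X in _ * (_ * X)]conjc_real mulrA.
Qed.
End Weights.

(** * Geometric sums *)

Section Geometric.
Variable (R : realFieldType).
Implicit Types b : R.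

(* [sum_{i,j < n} b^|i-j|] *)
Definition geom_variance b n : R :=
  \sum_(m < n) (1 + 2 * \sum_(j < m) b ^+ (m - j)).

(** The exponents run from [m] down to 1; keeping the factor [1 - b] on the left avoids division. *)
Lemma geom_sum b m : (1 - b) * \sum_(j < m) b ^+ (m - j) = b * (1 - b ^+ m).
Proof.
elim: m => [|m IH]; first by rewrite big_ord0 expr0; ring.
have E : \sum_(j < m) b ^+ (m.+1 - j) = b * \sum_(j < m) b ^+ (m - j).
  by rewrite mulr_sumr; apply: eq_bigr => j _; rewrite -exprS subSn // ltnW.
by rewrite big_ord_recr /= E subSnn expr1 mulrDr mulrCA IH exprS; ring.
Qed.

Lemma geom_varianceE b n :
  (1 - b) ^+ 2 * geom_variance b n = n%:R * (1 - b ^+ 2) - 2 * b * (1 - b ^+ n).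
Proof.
rewrite /geom_variance; elim: n => [|n IH].
  by rewrite big_ord0 expr0; ring.
rewrite big_ord_recr /= mulrDr IH.
have E x : (1 - b) ^+ 2 * (1 + 2 * x) =
  (1 - b) ^+ 2 + 2 * (1 - b) * ((1 - b) * x) by ring.
by rewrite E geom_sum [b ^+ n.+1]exprS -[n.+1%:R]natr1; ring.
Qed.

Lemma geom_variance_le b n : `|b| < 1 ->
  geom_variance b n <= 2 * n%:R / (1 - b).
Proof.
move=> b1; have b_lt1 : b < 1 := le_lt_trans (ler_norm b) b1.
have b0 : 0 < 1 - b by rewrite subr_gt0.
(* This is the claim multiplied by [(1 - b)^2], after inserting [geom_varianceE]. *)
have T m : 0 <= m%:R * (1 - b) ^+ 2 + 2 * b * (1 - b ^+ m).
  elim: m => [|m IH]; first by rewrite expr0; lra.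
  have bm : `|b ^+ m.+1| <= `|b|.
    by rewrite normrX exprS ler_piMr // exprn_ile1 // ltW.
  (* Times [1 - b], this is the increment of the induction. For negative [b], [b^(m+1) >= b] leaves
     [1 + b > 0]. *)
  have : 0 <= 1 - b + 2 * b ^+ m.+1.
    have [b_ge0|b_lt0] := lerP 0 b.
      by rewrite addr_ge0 ?mulr_ge0 ?exprn_ge0 // ltW.
    move: bm; rewrite ler_norml (ltr0_norm b_lt0) => /andP[bm _].
    by rewrite (ltr0_norm b_lt0) in b1; lra.
  move=> /(mulr_ge0 (ltW b0)); move: IH.
  rewrite [b ^+ m.+1]exprS -[m.+1%:R]natr1; lra.
rewrite -(ler_pM2l (exprn_gt0 2 b0)) geom_varianceE.
have -> : (1 - b) ^+ 2 * (2 * n%:R / (1 - b)) = (1 - b) * (2 * n%:R).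
  by field; rewrite gt_eqF.
by have := T n; lra.
Qed.

(** The exact correction is [2 b (1 - b^n) / (1 - b)^2], whose factor [b (1 - b^n)] is at most 1. It
    is applied with [b] the second eigenvalue and [c] the value [beta_star]. *)
Lemma geom_variance_ge b c n : `|b| <= c -> c < 1 ->
  n%:R * (1 + b) / (1 - b) - 2 / (1 - c) ^+ 2 <= geom_variance b n.
Proof.
move=> bc c1; have b1 : `|b| < 1 := le_lt_trans bc c1.
have b0 : 0 < 1 - b by rewrite subr_gt0 (le_lt_trans (ler_norm b)).
have -> : geom_variance b n =
    n%:R * (1 + b) / (1 - b) - 2 * (b * (1 - b ^+ n)) / (1 - b) ^+ 2.
  apply: (mulfI (lt0r_neq0 (exprn_gt0 2 b0))); rewrite geom_varianceE.
  by field; rewrite gt_eqF.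
rewrite lerB //.
apply: (@le_trans _ _ (2 / (1 - b) ^+ 2)).
  rewrite ler_pM2r ?invr_gt0 ?exprn_gt0 //.
  have : 0 <= 1 - b ^+ n.
    by rewrite subr_ge0 (le_trans (ler_norm _)) // normrX exprn_ile1 // ltW.
  have [b_ge0|b_lt0] := lerP 0 b; last first.
    by move=> /(mulr_le0_ge0 (ltW b_lt0)); lra.
  have := mulr_ge0 b_ge0 (exprn_ge0 n b_ge0); lra.
have c0 : 0 < 1 - c by rewrite subr_gt0.
have bc' : b <= c := le_trans (ler_norm b) bc.
rewrite ler_pM2l // lef_pV2 ?posrE ?exprn_gt0 //.
by rewrite ler_pXn2r ?nnegrE ?(ltW b0) ?(ltW c0) //; lra.
Qed.

(** The full series sums to [(1 + b) / (1 - b)^2]; the closed form of the partial sum shows that the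
    tail is nonnegative. *)
Lemma linear_geom_sum_le b n : 0 <= b -> b < 1 ->
  \sum_(m < n) (1 + 2 * m%:R) * b ^+ m <= 2 / (1 - b) ^+ 2.
Proof.
move=> b0 b1.
have c0 : 0 < 1 - b by rewrite subr_gt0.
rewrite -(ler_pM2l (exprn_gt0 2 c0)) mulrCA divff ?gt_eqF ?exprn_gt0 // mulr1.
have -> : (1 - b) ^+ 2 * \sum_(m < n) (1 + 2 * m%:R) * b ^+ m =
    1 + b - b ^+ n * ((1 + 2 * n%:R) * (1 - b) + 2 * b).
  elim: n => [|n IH]; first by rewrite big_ord0 expr0; ring.
  by rewrite big_ord_recr /= mulrDr IH [b ^+ n.+1]exprS -[n.+1%:R]natr1; ring.
have : 0 <= b ^+ n * ((1 + 2 * n%:R) * (1 - b) + 2 * b).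
  apply: mulr_ge0; first exact: exprn_ge0.
  apply: addr_ge0; last exact: mulr_ge0.
  by apply: mulr_ge0; rewrite ?(ltW c0) // addr_ge0 // mulr_ge0.
by lra.
Qed.
End Geometric.

(** * Comparison of second moments *)

(* E[(sum_{m<n} g(X_{n0+m+1}))^2] for the chain with initial distribution [mu],
   see [expectation_sqr_sum]. *)
Definition second_moment (R : realType) (D : finType) (p : D -> D -> R)
    (mu g : D -> R) (n0 n : nat) : R :=
  \sum_(m < n)
    (mean mu (iter (n0 + m) (transition_op p) (fun x => g x * g x)) +
     2 * \sum_(j < m) mean mu (iter (n0 + j) (transition_op p)
                         (fun x => g x * iter (m - j) (transition_op p) g x))).

Section Bounds.
Variables (R : realType) (D : finType) (p : D -> D -> R) (pi nu : D -> R).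
Hypotheses (sp : stochastic p) (dpi : is_distr pi) (rev : reversible p pi).
Hypotheses (pi_gt0 : forall x, 0 < pi x) (D_gt1 : (1 < #|D|)%N).
Hypotheses (beta_lt1 : beta_star p < 1) (dnu : is_distr nu).
Implicit Types (f g h : D -> R).
Local Notation P := (transition_op p).
Local Notation beta := (beta_star p).
Local Notation beta1 := (beta_ p 1).

Let pi_ge0 x : 0 <= pi x. Proof. exact: ltW. Qed.

Lemma beta_star_ge0 : 0 <= beta.
Proof. by rewrite le_max normr_ge0 orbT. Qed.

Lemma beta1_le : beta1 <= beta.
Proof. by rewrite le_max lexx. Qed.

Lemma spectral_weights_abs : exists e : 'I_#|D| -> R,
  forall g, mean pi g = 0 -> exists w : 'I_#|D| -> R,
  [/\ forall i, 0 <= w i,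
      forall i, w i != 0 -> `|e i| <= beta /\ e i <= beta1 &
      forall n, inner pi g (iter n P g) = \sum_i w i * e i ^+ n].
Proof.
have [e [_ H]] := spectral_weights sp dpi rev pi_gt0 D_gt1 beta_lt1.
exists e => g /H[w [w0 we wE]]; exists w; split => // i /we/andP[lo hi].
split=> //; rewrite ler_norml (le_trans hi beta1_le) andbT lerNl.
apply: (@le_trans _ _ (- beta_ p #|D|.-1)); first by rewrite lerN2.
by rewrite (le_trans (ler_norm _)) // normrN le_max lexx orbT.
Qed.

(** By self-adjointness the squared norm is [<g, P^(2n) g>], a mixture of the powers
    [e_i^(2n) <= beta^(2n)]. *)
Lemma l2norm_iter_le g n : mean pi g = 0 ->
  l2norm pi (iter n P g) <= beta ^+ n * l2norm pi g.
Proof.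
have [e H] := spectral_weights_abs.
move=> /H[w [w0 we wE]].
rewrite -(ler_pXn2r (n := 2)) ?nnegrE ?mulr_ge0 ?exprn_ge0 ?l2norm_ge0
  ?beta_star_ge0 //.
rewrite exprMn !sqr_l2norm // inner_iter // -iterD wE.
have -> : inner pi g g = \sum_i w i * e i ^+ 0 by rewrite -wE.
rewrite mulr_sumr; apply: ler_sum => i _.
rewrite expr0 mulr1 [leRHS]mulrC.
have [->|/we[ei _]] := eqVneq (w i) 0; first by rewrite !mul0r.
rewrite ler_wpM2l // -exprM muln2 -addnn (le_trans (ler_norm _)) // normrX.
by rewrite lerXn2r // nnegrE ?beta_star_ge0.
Qed.

Lemma mean_centered f : mean pi (fun x => f x - mean pi f) = 0.
Proof.
rewrite (mean_ext _ (f' := fun x => f x + (-1) * mean pi f)) => [|x];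
  last by ring.
by rewrite meanD mean_cst //; ring.
Qed.

Lemma inner_centered_le f :
  inner pi (fun x => f x - mean pi f) (fun x => f x - mean pi f)
    <= inner pi f f.
Proof.
have E m : inner pi (fun x => f x - m) (fun x => f x - m) =
    inner pi f f - 2 * m * mean pi f + m ^+ 2 * \sum_x pi x.
  rewrite /inner /mean !mulr_sumr -sumrB -big_split /=.
  by apply: eq_bigr => x _; ring.
rewrite E dpi.2 (_ : _ + _ = inner pi f f - mean pi f ^+ 2); last by ring.
by rewrite gerBl sqr_ge0.
Qed.

Lemma iter_centered f a n :
  iter n P (fun x => f x - a) =1 fun x => iter n P f x - a.
Proof.
move=> x; transitivity (iter n P (fun x => f x + (-1) * a) x).
  by apply: iter_transition_ext => y; ring.
by rewrite iter_transition_opD iter_transition_cst //; ring.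
Qed.

Lemma inner_norm_le f g : `|inner pi f g| <= l2norm pi f * l2norm pi g.
Proof.
rewrite -(ler_pXn2r (n := 2)) ?nnegrE ?mulr_ge0 ?l2norm_ge0 //.
by rewrite real_normK ?num_real // exprMn !sqr_l2norm // inner_cauchy_schwarz.
Qed.

(** The difference equals [<P^i k, nu/pi - 1>] with [k] the centered [h]. Cauchy-Schwarz and the
    decay of [P^i k] finish, since centering does not increase the norm. *)
Lemma mean_iter_decay h i :
  `|mean nu (iter i P h) - mean pi h| <=
  beta ^+ i * l2norm pi h * l2norm pi (fun x => nu x / pi x - 1).
Proof.
pose k x := h x - mean pi h.
have -> : mean nu (iter i P h) - mean pi h =
    inner pi (iter i P k) (fun x => nu x / pi x - 1).
  transitivity (mean nu (iter i P k) - mean pi (iter i P k)).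
    rewrite [mean pi (iter _ _ _)](mean_iter sp rev).
    rewrite [mean pi k]mean_centered subr0.
    rewrite [RHS](mean_ext _ (f' := fun x => iter i P h x + (-1) * mean pi h)).
      by rewrite meanD (mean_cst _ dnu); ring.
    by move=> x; rewrite /k iter_centered; ring.
  rewrite /mean /inner -sumrB; apply: eq_bigr => x _.
  by field; rewrite gt_eqF.
rewrite (le_trans (inner_norm_le _ _)) // ler_wpM2r ?l2norm_ge0 //.
rewrite (le_trans (l2norm_iter_le i (mean_centered h))) //.
rewrite ler_wpM2l ?exprn_ge0 ?beta_star_ge0 //.
by rewrite ler_wsqrtr // inner_centered_le.
Qed.

Local Notation pinvmax := (linfnorm (fun x => (pi x)^-1)).

(** The single term [g(x)^2 pi(x)] is at most the whole sum; divide by [pi(x)]. *)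
Lemma sqr_le_linfnorm_inner g x : g x ^+ 2 <= pinvmax * inner pi g g.
Proof.
have gx : g x ^+ 2 * pi x <= inner pi g g.
  rewrite /inner (bigD1 x) //= -expr2 lerDl; apply: sumr_ge0 => y _.
  by rewrite mulr_ge0 // -expr2 sqr_ge0.
have -> : g x ^+ 2 = (pi x)^-1 * (g x ^+ 2 * pi x) by field; rewrite gt_eqF.
apply: ler_pM => //; rewrite ?invr_ge0 ?(mulr_ge0 (sqr_ge0 _)) //.
apply: le_trans (ler_norm _) _.
exact: (le_bigmax 0 (fun y => `|(pi y)^-1|)).
Qed.

(** One factor is bounded pointwise through [1/pi], the other in [l2norm] by the spectral decay. *)
Lemma l2norm_mul_iter_le g k : mean pi g = 0 -> l2norm pi g <= 1 ->
  l2norm pi (fun x => g x * iter k P g x) <= Num.sqrt pinvmax * beta ^+ k.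
Proof.
move=> g0 g1.
have M0 : 0 <= pinvmax.
  by rewrite /linfnorm; elim/big_ind: _ => // x y x0 y0; rewrite le_max x0.
have gg1 : inner pi g g <= 1.
  by rewrite -sqr_l2norm // exprn_ile1 ?l2norm_ge0.
apply: (@le_trans _ _ (Num.sqrt pinvmax * l2norm pi (iter k P g))); last first.
  rewrite ler_wpM2l ?sqrtr_ge0 // (le_trans (l2norm_iter_le k g0)) //.
  by rewrite ler_piMr // exprn_ge0 // beta_star_ge0.
rewrite -sqrtrM // ler_wsqrtr // /inner mulr_sumr; apply: ler_sum => x _.
have -> : g x * iter k P g x * (g x * iter k P g x) * pi x =
  g x ^+ 2 * (iter k P g x * iter k P g x * pi x) by ring.
apply: ler_wpM2r; first by rewrite mulr_ge0 // -expr2 sqr_ge0.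
by rewrite (le_trans (sqr_le_linfnorm_inner g x)) // ler_piMr.
Qed.

Lemma second_moment_stationary g n0 n :
  second_moment p pi g n0 n =
  \sum_(m < n) (inner pi g g + 2 * \sum_(j < m) inner pi g (iter (m - j) P g)).
Proof.
apply: eq_bigr => m _; rewrite mean_iter //; congr (_ + 2 * _).
by apply: eq_bigr => j _; rewrite mean_iter.
Qed.

(** The weights add up to [<g, g> <= 1], and every [geom_variance (e i) n] of positive weight obeys
    the bound with [e i <= beta1]. *)
Lemma second_moment_stationary_le g n0 n : mean pi g = 0 -> l2norm pi g <= 1 ->
  second_moment p pi g n0 n <= 2 * n%:R / (1 - beta1).
Proof.
move=> g0 g1; rewrite second_moment_stationary.
have [e /(_ g g0)[w [w0 we wE]]] := spectral_weights_abs.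
have gg : inner pi g g = \sum_i w i.
  by have := wE 0%N; under eq_bigr do rewrite expr0 mulr1.
have -> : \sum_(m < n)
    (inner pi g g + 2 * \sum_(j < m) inner pi g (iter (m - j) P g))
  = \sum_i w i * geom_variance (e i) n.
  under [RHS]eq_bigr do rewrite mulr_sumr.
  rewrite exchange_big; apply: eq_bigr => m _ /=; rewrite gg.
  under [RHS]eq_bigr do rewrite mulrDr mulr1 mulrCA mulr_sumr.
  rewrite [RHS]big_split -mulr_sumr [in RHS]exchange_big; congr (_ + 2 * _).
  by apply: eq_bigr => j _; rewrite wE.
have b1 : 0 < 1 - beta1 by rewrite subr_gt0; apply: le_lt_trans beta1_le _.
have C0 : 0 <= 2 * n%:R / (1 - beta1) by rewrite divr_ge0 ?mulr_ge0 // ltW.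
apply: (@le_trans _ _ (\sum_i w i * (2 * n%:R / (1 - beta1)))); last first.
  by rewrite -mulr_suml -gg ler_piMl // -sqr_l2norm // exprn_ile1 ?l2norm_ge0.
apply: ler_sum => i _.
have [->|/we[ei ei1]] := eqVneq (w i) 0; first by rewrite !mul0r.
rewrite ler_wpM2l //.
rewrite (le_trans (geom_variance_le _ (le_lt_trans ei beta_lt1))) //.
have b1e : 1 - beta1 <= 1 - e i by rewrite lerD2l lerN2.
by rewrite ler_wpM2l ?mulr_ge0 // lef_pV2 ?posrE // (lt_le_trans b1).
Qed.

(** The pair [(j, m)] contributes an error of at most [beta^(j + (m - j)) = beta^m], whatever [j]
    is. Row [m] has one diagonal term and [m] doubled ones, hence the factor [1 + 2m]. *)
Lemma second_moment_diff_le g n0 n : mean pi g = 0 -> l2norm pi g <= 1 ->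
  Num.sqrt pinvmax * l2norm pi (fun x => nu x / pi x - 1) * beta ^+ n0 <= 1 ->
  `|second_moment p nu g n0 n - second_moment p pi g n0 n| <=
  2 / (1 - beta) ^+ 2.
Proof.
move=> g0 g1; set a := Num.sqrt pinvmax; set c := l2norm pi _ => abeta.
have D_le i k :
    `|mean nu (iter (n0 + i) P (fun x => g x * iter k P g x)) -
      mean pi (iter (n0 + i) P (fun x => g x * iter k P g x))|
    <= beta ^+ (i + k).
  rewrite [mean pi _]mean_iter // (le_trans (mean_iter_decay _ _)) // -/c.
  apply: (@le_trans _ _ (beta ^+ (n0 + i) * (a * beta ^+ k) * c)).
    rewrite ler_wpM2r ?l2norm_ge0 // ler_wpM2l ?exprn_ge0 ?beta_star_ge0 //.
    exact: l2norm_mul_iter_le.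
  have -> : beta ^+ (n0 + i) * (a * beta ^+ k) * c =
            (a * c * beta ^+ n0) * beta ^+ (i + k) by rewrite !exprD; ring.
  by rewrite ler_piMl // exprn_ge0 // beta_star_ge0.
apply: le_trans (linear_geom_sum_le n beta_star_ge0 beta_lt1).
rewrite -sumrB (le_trans (ler_norm_sum _ _ _)) //; apply: ler_sum => m _.
have diffE (a1 a2 : R) (b1 b2 : 'I_m -> R) :
    a1 + 2 * \sum_j b1 j - (a2 + 2 * \sum_j b2 j) =
    (a1 - a2) + 2 * \sum_j (b1 j - b2 j) by rewrite sumrB; ring.
rewrite diffE [leRHS]mulrDl mul1r.
rewrite (le_trans (ler_normD _ _)) // lerD //.
  by have := D_le m 0%N; rewrite addn0.
rewrite normrM ger0_norm // -mulrA ler_wpM2l //.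
rewrite (le_trans (ler_norm_sum _ _ _)) // mulr_natl.
rewrite -[X in _ *+ X]card_ord -sumr_const.
by apply: ler_sum => j _; have := D_le j (m - j)%N; rewrite subnKC // ltnW.
Qed.

(** For a normalized eigenfunction of [beta1] the autocovariances are [beta1^k], so the second
    moment is exactly [geom_variance beta1 n]. *)
Lemma second_moment_eigenfunction_ge n0 n : exists g,
  [/\ mean pi g = 0, l2norm pi g = 1 &
   n%:R * (1 + beta1) / (1 - beta1) - 2 / (1 - beta) ^+ 2
     <= second_moment p pi g n0 n].
Proof.
have sz : size (eigenvalues p) = #|D|.
  have [e [c [chiE _ _]]] := reversible_spectral rev pi_gt0.
  by rewrite (perm_size (perm_eigenvalues chiE)) size_map size_enum_ord.
have D0 : (1 < size (eigenvalues p))%N by rewrite sz.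
have root1 : root (char_poly (transition_mx p)) beta1.
  have [e [c [chiE _ _]]] := reversible_spectral rev pi_gt0.
  have := mem_nth 0 D0.
  rewrite -/(beta_ p 1) (perm_mem (perm_eigenvalues chiE)).
  move=> /mapP[i _ ->]; rewrite chiE rootE horner_prod.
  by rewrite (bigD1 i) //= !hornerE subrr mul0r.
have [g gg Pg] := eigenfunction sp rev pi_gt0 root1.
have Png k : iter k P g =1 fun x => beta1 ^+ k * g x.
  elim: k => [|k IH] x; first by rewrite expr0 mul1r.
  rewrite /= (transition_op_ext _ IH).
  transitivity (beta1 ^+ k * P g x); last by rewrite Pg exprSr mulrA.
  by rewrite /transition_op mulr_sumr; apply: eq_bigr => y _; rewrite mulrA.
exists g; split.
(* Stationarity gives [mean g = beta1 * mean g], and [beta1 < 1]. *)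
- have := mean_iter sp rev g 1; rewrite (mean_ext _ Pg).
  have -> : mean pi (fun x => beta1 * g x) = beta1 * mean pi g.
    by rewrite /mean mulr_sumr; apply: eq_bigr => x _; rewrite mulrA.
  move/eqP; rewrite -subr_eq0 -[X in _ - X]mul1r -mulrBl mulf_eq0 subr_eq0.
  by rewrite lt_eqF ?(le_lt_trans beta1_le) //= => /eqP.
- by rewrite /l2norm gg sqrtr1.
- rewrite second_moment_stationary gg.
  have gPg k : inner pi g (iter k P g) = beta1 ^+ k.
    rewrite (inner_ext _ (frefl g) (Png k)) -[RHS]mulr1 -gg /inner mulr_sumr.
    by apply: eq_bigr => x _; ring.
  under eq_bigr do under eq_bigr do rewrite gPg.
  apply: geom_variance_ge beta_lt1.
  rewrite ler_norml beta1_le andbT lerNl.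
  have b1_ge : beta_ p #|D|.-1 <= beta1 by apply: beta_le; rewrite sz; lia.
  apply: (@le_trans _ _ (- beta_ p #|D|.-1)); first by rewrite lerN2.
  by rewrite (le_trans (ler_norm _)) // normrN le_max lexx orbT.
Qed.

(** If [a = 0] the bound is trivial; otherwise the ceiling gives [n0 >= ln a / ln (1/beta)], that
    is, [a <= beta^(-n0)]. *)
Lemma burn_in_le n0 : 0 < beta -> n0%:Z = burn_in p pi nu ->
  Num.sqrt pinvmax * l2norm pi (fun x => nu x / pi x - 1) * beta ^+ n0 <= 1.
Proof.
move=> b0; rewrite /burn_in; set a := _ * _.
have a_ge0 : 0 <= a by rewrite mulr_ge0 ?sqrtr_ge0 // l2norm_ge0.
have [->|a0] := eqVneq a 0; first by rewrite mul0r.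
have a_gt0 : 0 < a by rewrite lt_neqAle eq_sym a0.
have lb : 0 < ln beta^-1 by rewrite ln_gt0 // invf_gt1.
move=> n0E.
have : ln a / ln beta^-1 <= n0%:R.
  rewrite -[n0%:R]/((n0%:Z)%:~R) n0E.
  apply: le_trans (ceil_ge _) _; rewrite ler_int le_max lexx //.
rewrite ler_pdivrMr //.
have -> : n0%:R * ln beta^-1 = ln (beta^-1 ^+ n0).
  by rewrite lnXn ?invr_gt0 // mulr_natl.
rewrite ler_ln ?posrE ?exprn_gt0 ?invr_gt0 // exprVn => ab.
by rewrite -ler_pdivlMr ?exprn_gt0 // div1r.
Qed.
End Bounds.

(** * Expectations along the chain *)

Section Prob.
Context {d : measure_display} {T : measurableType d} {R : realType}.
Variable Pr : probability T R.

Lemma expectation_finite (F : finType) (Y : T -> F) (G : F -> R) :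
  (forall y, measurable [set w | Y w = y]) ->
  'E_Pr[fun w => G (Y w)]%E = (\sum_y G y * fine (Pr [set w | Y w = y]))%:E.
Proof.
move=> mY; rewrite unlock.
transitivity (\int[Pr]_w
    (\sum_(y : F) ((G y)%:E * (\1_[set w | Y w = y] w)%:E)))%E.
  apply: eq_integral => w _; rewrite (bigD1 (Y w)) //= big1 ?adde0.
    by rewrite indicE mem_set // mule1.
  move=> y yY; rewrite indicE memNset ?mule0 //= => /esym/eqP.
  by rewrite (negPf yY).
rewrite integral_sum // => [|y]; last first.
  by apply: integrableZl => //; exact: integrable_indic.
rewrite -sumEFin; apply: eq_bigr => y _.
rewrite integralZl //; last exact: integrable_indic.
by rewrite integral_indic // setIT EFinM fineK // fin_num_measure.
Qed.

Context {D : finType}.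
Variables (p : D -> D -> R) (nu : D -> R) (X : nat -> T -> D).
Hypothesis chain : markov_chain Pr p nu X.
Local Notation P := (transition_op p).

Let mX n x : measurable [set w | X n.+1 w = x].
Proof. by case: chain => + _ _; apply. Qed.

(** Coordinate [i] is the state at time [i + 1]. The values form a finite type, which turns
    expectations into finite sums. *)
Definition trajectory n (w : T) : {ffun 'I_n -> D} :=
  [ffun i : 'I_n => X i.+1 w].

Lemma measurable_trajectory n y : measurable [set w | trajectory n w = y].
Proof.
have -> : [set w | trajectory n w = y] =
    \bigcap_(i in [set: 'I_n]) [set w | X i.+1 w = y i].
  apply/seteqP; split=> w /=; first by move=> <- i _ /=; rewrite ffunE.
  by move=> H; apply/ffunP => i; rewrite ffunE; apply: H.
by apply: fin_bigcap_measurable => // i _; exact: mX.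
Qed.

Lemma trajectory_step n y z :
  fine (Pr [set w | (trajectory n.+1 w, X n.+2 w) = (y, z)]) =
  fine (Pr [set w | trajectory n.+1 w = y]) * p (y ord_max) z.
Proof.
case: chain => _ _ /(_ n.+1 (fun k => y (inord k.-1)) z isT) /=.
have -> : [set w | forall k, (1 <= k <= n.+1)%N -> X k w = y (inord k.-1)] =
    [set w | trajectory n.+1 w = y].
  apply/seteqP; split=> w /= H.
    apply/ffunP => i; rewrite ffunE H /=; last exact: ltn_ord.
    by rewrite inord_val.
  by case=> // k kn /=; rewrite -H ffunE inordK.
rewrite (_ : inord n = ord_max); last by apply: val_inj; rewrite /= inordK.
have -> : [set w | (trajectory n.+1 w, X n.+2 w) = (y, z)] =
    [set w | X n.+2 w = z] `&` [set w | trajectory n.+1 w = y].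
  by apply/seteqP; split=> w /= [-> ->].
have mB := measurable_trajectory y.
(* The Markov property speaks only of pasts of positive probability; for a null past both sides
   vanish. *)
have [B0|] := eqVneq (Pr [set w | trajectory n.+1 w = y]) 0%E.
  move=> _; rewrite B0 mul0r (_ : Pr _ = 0%E) //; apply/eqP.
  rewrite eq_le measure_ge0 andbT -B0 le_measure ?inE //.
  exact: measurableI.
rewrite -measure_gt0 => B0 /(_ B0) <-; rewrite /cond_prob mulrC divfK //.
by rewrite gt_eqF // fine_gt0 // B0 -ge0_fin_numE // fin_num_measure.
Qed.

Lemma expectation_trajectory n (G : {ffun 'I_n -> D} -> R) :
  'E_Pr[fun w => G (trajectory n w)]%E =
  (\sum_y G y * fine (Pr [set w | trajectory n w = y]))%:E.
Proof. exact/expectation_finite/measurable_trajectory. Qed.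

(** This is the tower property: against any function of the past, [h] of the next state may be
    replaced by its conditional expectation [P h]. *)
Lemma expectation_step n (F : {ffun 'I_n.+1 -> D} -> R) (h : D -> R) :
  ('E_Pr[fun w => (F (trajectory n.+1 w) * h (X n.+2 w))%R] =
   'E_Pr[fun w => (F (trajectory n.+1 w) * P h (X n.+1 w))%R])%E.
Proof.
have last_trajectory w : X n.+1 w = trajectory n.+1 w ord_max by rewrite ffunE.
under [in RHS]eq_fun do rewrite last_trajectory.
rewrite (expectation_trajectory (fun y => F y * P h (y ord_max))).
rewrite (@expectation_finite _ (fun w => (trajectory n.+1 w, X n.+2 w))
  (fun yz => F yz.1 * h yz.2)).
  congr EFin; transitivity (\sum_y \sum_z F y * h z *
      fine (Pr [set w | (trajectory n.+1 w, X n.+2 w) = (y, z)])).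
    by rewrite pair_bigA; apply: eq_bigr => -[y z].
  apply: eq_bigr => y _; under eq_bigr do rewrite trajectory_step.
  rewrite /transition_op mulrAC mulr_sumr; apply: eq_bigr => z _; ring.
case=> y z.
have -> : [set w | (trajectory n.+1 w, X n.+2 w) = (y, z)] =
    [set w | X n.+2 w = z] `&` [set w | trajectory n.+1 w = y].
  by apply/seteqP; split=> w /= [-> ->].
apply: measurableI; [exact: mX|exact: measurable_trajectory].
Qed.

Lemma expectation_marginal (h : D -> R) i :
  ('E_Pr[fun w => h (X i.+1 w)] = (mean nu (iter i P h))%:E)%E.
Proof.
elim: i h => [|i IH] h /=.
  rewrite (expectation_finite h (mX 0)) /mean; congr EFin.
  by apply: eq_bigr => x _; case: chain => _ -> _.
rewrite -iterS iterSr -IH.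
have := expectation_step (n := i) (fun=> 1) h.
by under eq_fun do rewrite mul1r; under [in RHS]eq_fun do rewrite mul1r.
Qed.

(** Induction on the lag [k] peels off the latest step, with [f (X i.+1)] as a function of the
    past. *)
Lemma expectation_joint (f h : D -> R) i k :
  ('E_Pr[fun w => (f (X i.+1 w) * h (X (i + k).+1 w))%R] =
   (mean nu (iter i P (fun x => f x * iter k P h x)%R))%:E)%E.
Proof.
elim: k h => [|k IH] h.
  by rewrite addn0 -(expectation_marginal (fun x => f x * h x)).
rewrite iterSr -IH addnS.
have := expectation_step (n := i + k) (fun y => f (y (inord i))) h.
have E w : trajectory (i + k).+1 w (inord i) = X i.+1 w.
  by rewrite ffunE inordK // ltnS leq_addr.
by under eq_fun do rewrite E; under [in RHS]eq_fun do rewrite E.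
Qed.

(** Diagonal plus twice the lower triangle, arranged by rows to match [second_moment]. *)
Lemma sqr_sum_ord (z : nat -> R) n :
  (\sum_(m < n) z m) ^+ 2 =
  \sum_(m < n) (z m * z m + 2 * \sum_(j < m) z j * z m).
Proof.
elim: n => [|n IH]; first by rewrite !big_ord0 expr0n.
by rewrite !big_ord_recr /= -IH -mulr_suml; ring.
Qed.

Lemma expectation_sqr_sum (c : R) (g : D -> R) n0 n :
  ('E_Pr[fun w => ((c * \sum_(m < n) g (X (n0 + m).+1 w)) ^+ 2)%R] =
   (c ^+ 2 * second_moment p nu g n0 n)%:E)%E.
Proof.
(* All variables are read off one trajectory. Its length [(n0 + n).+1] is one more than needed, so
   that [inord] is available even when [n0 + n = 0]. *)
pose Y m (y : {ffun 'I_(n0 + n).+1 -> D}) := g (y (inord (n0 + m))).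
pose q y := fine (Pr [set w | trajectory (n0 + n).+1 w = y]).
have YE m w : (m < n)%N -> g (X (n0 + m).+1 w) = Y m (trajectory (n0 + n).+1 w).
  by move=> mn; rewrite /Y ffunE inordK // ltnS leq_add2l ltnW.
have joint j m : (j <= m < n)%N -> \sum_y Y j y * Y m y * q y =
    mean nu (iter (n0 + j) P (fun x => g x * iter (m - j) P g x)).
  move=> /andP[jm mn]; apply: EFin_inj.
  rewrite -expectation_joint -(expectation_trajectory (fun y => Y j y * Y m y)).
  congr expectation; apply/funext => w.
  by rewrite -!YE ?(leq_ltn_trans jm) // -addnA subnKC.
have -> : (fun w => (c * \sum_(m < n) g (X (n0 + m).+1 w)) ^+ 2) =
    fun w => (c * \sum_(m < n) Y m (trajectory (n0 + n).+1 w)) ^+ 2.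
  apply/funext => w; congr ((_ * _) ^+ 2); apply: eq_bigr => m _; exact: YE.
rewrite (expectation_trajectory (fun y => (c * \sum_(m < n) Y m y) ^+ 2)).
congr EFin.
under eq_bigr => y _ do
  rewrite -/(q y) exprMn (sqr_sum_ord (Y ^~ y)) -mulrA mulr_suml.
rewrite -mulr_sumr; congr (_ * _).
rewrite exchange_big /=; apply: eq_bigr => m _.
  under eq_bigr do rewrite mulrDl -[2 * _ * _]mulrA mulr_suml.
rewrite big_split /= joint ?leqnn ?ltn_ord // subnn -mulr_sumr exchange_big /=.
congr (_ + 2 * _); apply: eq_bigr => j _.
by rewrite joint // ltn_ord ltnW // ltn_ord.
Qed.

Lemma sqr_mcmc_error (pi f : D -> R) n0 n : (0 < n)%N ->
  (mcmc_error Pr X pi n n0 f ^+ 2)%E =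
  (n%:R ^- 2 * second_moment p nu (fun x => f x - mean pi f) n0 n)%:E.
Proof.
move=> n_gt0; rewrite /mcmc_error sqr_sqrte; last first.
  by apply: expectation_ge0 => w; exact: exprn_ge0.
pose g x := f x - mean pi f.
have -> : (fun w => `|mcmc_avg X n n0 f w - mean pi f| ^+ 2) =
    fun w => (n%:R^-1 * \sum_(m < n) g (X (n0 + m).+1 w)) ^+ 2.
  apply/funext => w; rewrite real_normK ?num_real //; congr (_ ^+ 2).
  rewrite sumrB sumr_const card_ord mulrBr -[mean pi f *+ n]mulr_natl.
  rewrite mulKf ?pnatr_eq0 -?lt0n // /mcmc_avg big_add1 /= big_mkord.
  by congr (_ * _ - _); apply: eq_bigr => m _; rewrite addSn addnC.
by rewrite expectation_sqr_sum exprVn.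
Qed.
End Prob.

(** * The two bounds on the worst-case error *)

Theorem theorem2p25
  (R : realType) (D : finType) (p : D -> D -> R) (pi nu : D -> R)
  (d : measure_display) (T : measurableType d) (Pr : probability T R)
  (X : nat -> T -> D) (n0 : nat) :
  (1 < #|D|)%N ->
  stochastic p -> irreducible p -> aperiodic p ->
  is_distr pi -> reversible p pi ->
  is_distr nu ->
  markov_chain Pr p nu X ->
  0 < beta_star p < 1 ->
  n0%:Z = burn_in p pi nu ->
  forall n : nat, (0 < n)%N ->
  let worst := ereal_sup
    [set (mcmc_error Pr X pi n n0 f ^+ 2)%E |
       f in [set f : D -> R | l2norm pi f <= 1]] in
  (((1 + beta_ p 1) / (n%:R * (1 - beta_ p 1))
      - 4 / (n%:R ^+ 2 * (1 - beta_star p) ^+ 2))%R%:E <= worst)%E /\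
  (worst <= (2 / (n%:R * (1 - beta_ p 1))
      + 2 / (n%:R ^+ 2 * (1 - beta_star p) ^+ 2))%R%:E)%E.
Proof.
move=> D_gt1 sp irr _ dpi rev dnu chain /andP[beta_gt0 beta_lt1] n0E n n_gt0.
move=> worst.
have pi_gt0 x : 0 < pi x := reversible_distr_gt0 dpi rev x irr.
have abeta := burn_in_le beta_lt1 beta_gt0 n0E.
have diff g : mean pi g = 0 -> l2norm pi g <= 1 ->
    `|second_moment p nu g n0 n - second_moment p pi g n0 n| <=
    2 / (1 - beta_star p) ^+ 2.
  by move=> g0 g1; apply: second_moment_diff_le.
have n0' : n%:R != 0 :> R by rewrite pnatr_eq0 -lt0n.
have b1 : 1 - beta_ p 1 != 0.
  by rewrite gt_eqF // subr_gt0; apply: le_lt_trans (beta1_le p) _.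
have b2 : 1 - beta_star p != 0 by rewrite gt_eqF // subr_gt0.
have in2 : 0 < n%:R ^- 2 :> R by rewrite invr_gt0 exprn_gt0 // ltr0n.
split.
- have [g [g0 g1 gE]] :=
    second_moment_eigenfunction_ge sp rev pi_gt0 D_gt1 beta_lt1 n0 n.
  (* The supremum is at least its value at the eigenfunction [g], which is already centered. *)
  apply: (@le_trans _ _ (mcmc_error Pr X pi n n0 g ^+ 2)%E); last first.
    by apply: ereal_sup_ubound; exists g => //=; rewrite g1.
  rewrite (sqr_mcmc_error chain) // lee_fin.
  have -> : (fun x => g x - mean pi g) = g.
    by apply/funext => x; rewrite g0 subr0.
  (* The constant 4 is 2 from the geometric lower bound plus 2 from the change of initial
     distribution. *)
  have -> : (1 + beta_ p 1) / (n%:R * (1 - beta_ p 1))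
      - 4 / (n%:R ^+ 2 * (1 - beta_star p) ^+ 2) =
    n%:R ^- 2 * ((n%:R * (1 + beta_ p 1) / (1 - beta_ p 1)
      - 2 / (1 - beta_star p) ^+ 2) - 2 / (1 - beta_star p) ^+ 2).
    by field; rewrite n0' b1 b2.
  rewrite ler_pM2l //; have := diff g g0; rewrite g1 => /(_ (lexx _)).
  rewrite ler_norml => /andP[+ _]; lra.
- apply: ub_ereal_sup => _ [f f1 <-]; rewrite (sqr_mcmc_error chain) // lee_fin.
  (* The error depends only on the centered [g], which stays in the unit ball. *)
  pose g x := f x - mean pi f; rewrite -/g.
  have g0 : mean pi g = 0 := mean_centered dpi f.
  have g1 : l2norm pi g <= 1.
    by apply: le_trans f1; rewrite ler_wsqrtr // inner_centered_le.
  have -> : 2 / (n%:R * (1 - beta_ p 1))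
      + 2 / (n%:R ^+ 2 * (1 - beta_star p) ^+ 2) =
    n%:R ^- 2 * (2 * n%:R / (1 - beta_ p 1) + 2 / (1 - beta_star p) ^+ 2)
    by field; rewrite n0' b1 b2.
  rewrite ler_pM2l //; have := diff g g0 g1.
  have :=
    second_moment_stationary_le sp dpi rev pi_gt0 D_gt1 beta_lt1 n0 n g0 g1.
  rewrite ler_norml => H /andP[_]; lra.
Qed.
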